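(* For any fixed integer $k\ge 2$ and $r$ tending to infinity, we have $R_{\mathrm{list}}(rK_2,k)=2r+o(r)$. In particular, $$\frac{R(rK_2,k)}{R_{\mathrm{list}}(rK_2,k)}=\frac{k+1}{2}+o(1).$$ For any fixed integer $r\ge 2$ and $k$ tending to infinity, we have $R_{\mathrm{list}}(rK_2,k)=\Theta(k/\log k)$. In particular, $$\frac{R(rK_2,k)}{R_{\mathrm{list}}(rK_2,k)}=\Theta(\log k).$$
   Context: $K_n$ is the complete graph on $n$ vertices and $rK_2$ is the matching consisting of $r$ pairwise vertex-disjoint edges. For a graph $G$ and a positive integer $k$, the ordinary Ramsey number $R(G,k)$ is the smallest $n$ such that every colouring of $E(K_n)$ with the colours $\{1,\dots,k\}$ contains a monochromatic copy of $G$. Given an assignment $L$ of a set $L_e\subseteq\mathbb{N}$ to each edge $e$ of $K_n$, an $L$-colouring is a function $c:E(K_n)\to\mathbb{N}$ with $c(e)\in L_e$ for all $e$. The list Ramsey number $R_{\mathrm{list}}(G,k)$ is the smallest $n$ for which there exists an assignment $L$ of lists with $|L_e|=k$ for every $e\in E(K_n)$ such that every $L$-colouring of $E(K_n)$ contains a monochromatic copy of $G$ (a not necessarily induced subgraph isomorphic to $G$ all of whose edges have the same colour). Logarithms are natural. *)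

(* Defs.v *)
(* MathComp / MathComp-Analysis. *)
From mathcomp Require Export all_boot all_order all_algebra finmap.
From mathcomp Require Export all_classical all_reals all_analysis.
Export Order.TTheory GRing.Theory Num.Theory numFieldNormedType.Exports.

Set Implicit Arguments.
Unset Strict Implicit.
Unset Printing Implicit Defensive.

Record sgraph := SGraph {
  vertex :> finType;
  adj : rel vertex;
  adj_sym : symmetric adj;
  adj_irr : irreflexive adj }.

(* The matching with [r] edges: the [i]-th edge joins [(i, false)] and
   [(i, true)]. *)
Section Matching.
Variable r : nat.

Definition matching_adj : rel ('I_r * bool) :=
  fun x y => (x.1 == y.1) && (x.2 != y.2).

Lemma matching_sym : symmetric matching_adj.
Proof. by move=> x y; rewrite /matching_adj eq_sym [y.2 == _]eq_sym. Qed.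

Lemma matching_irr : irreflexive matching_adj.
Proof. by move=> x; rewrite /matching_adj !eqxx. Qed.

Definition matching : sgraph := SGraph matching_sym matching_irr.

End Matching.

Definition Kedge (n : nat) := {e : {set 'I_n} | #|e| == 2}.

(* [f] embeds [G] in [K_n] as a not necessarily induced subgraph; as [f] is
   injective and adjacency is irreflexive, [[set f u; f v]] is an edge. *)
Definition has_mono_copy (G : sgraph) (n : nat) (C : Type)
    (c : Kedge n -> C) : Prop :=
  exists f : G -> 'I_n, injective f /\
    exists a : C, forall u v : G, adj u v ->
      forall e : Kedge n, val e = [set f u; f v] -> c e = a.

(* Junk value 0 when [P] is nowhere satisfied; for the two uses below with
   [0 < k], Ramsey's theorem makes [P] satisfiable. *)
Definition smallest (P : nat -> Prop) : nat :=
  xget 0%N [set n | P n /\ forall m, P m -> (n <= m)%N]%classic.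

Lemma smallestP (P : nat -> Prop) : (exists n, P n) ->
  P (smallest P) /\ forall m, P m -> (smallest P <= m)%N.
Proof.
move=> [n Pn]; rewrite /smallest; case: xgetP => [_ -> //|noP].
have exP : exists n, `[< P n >] by exists n; apply/asboolP.
have [m /asboolP Pm m_min] := ex_minnP exP.
by case: (noP m); split=> // j Pj; apply: m_min; apply/asboolP.
Qed.

Definition ramsey (G : sgraph) (k : nat) : nat :=
  smallest (fun n => forall c : Kedge n -> 'I_k, has_mono_copy G c).

Definition list_colouring (n : nat) (L : Kedge n -> {fset nat})
    (c : Kedge n -> nat) : Prop :=
  forall e, c e \in L e.

Definition list_ramsey (G : sgraph) (k : nat) : nat :=
  smallest (fun n => exists L : Kedge n -> {fset nat},
    (forall e, #|` L e| = k) /\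
    forall c, list_colouring L c -> has_mono_copy G c).

(* Main.v *)
Require Import Defs.
From mathcomp Require Import perm fintype finset zify ring lra.
Set Implicit Arguments.
Unset Strict Implicit.
Unset Printing Implicit Defensive.

(** Write [rK2] for the matching with [r] edges.

    ** Ordinary Ramsey numbers.
    The value is [(k+1)(r-1)+2] (Cockayne and Lorimer); an error of 1 does not
    matter here.  For the upper bound ([ramsey_matching_upper]), a colour class
    without [rK2] has, by the Tutte-Berge formula ([tutte_berge]), a set [S] and a
    partition of the remaining vertices such that all edges avoiding [S] lie
    inside parts and [#|S|] plus the sum of the [#|C|./2] over the parts is at
    most [r-1].  Delete the sets [S] of all colours: the parts of the various
    colours now cover every pair of the remaining vertices, and a double count
    around the largest part bounds their number ([clique_cover]).  The lower bound
    is a colouring with one clique and stars around small sets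
    ([ramsey_matching_lower]).

    ** Lists forcing a monochromatic matching.
    A graph without [rK2] has a vertex cover of fewer than [2r] vertices, the
    vertices met by a maximum matching.  Choose all lists at random among the
    [k]-subsets of [M] colours.  If some colouring from the lists has no
    monochromatic [rK2], then there are [M] sets of at most [2r] vertices, one
    for each colour, such that every edge [e] has in its list a colour whose set meets
    [e].  There are at most [n^(2rM)] such families of sets.  For a fixed family
    the total number of incidences between colours and edges is small, so many
    edges are met by the sets of few colours, and each of these has a list
    missing all these colours with probability at least [rho].  The union bound
    works as soon as [n^(2rM) (1-rho)^E < 1], [E] being the number of these edges
    ([list_ramsey_criterion]).  This is used in two ranges.
    - For [k] fixed, [n = 2r + r/q] and [M] a large constant: a positive
      proportion of the edges avoid the sets of at least [k] colours, [rho]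
      is a positive constant, and [r log r] is negligible against [r^2]
      ([forcing_nearly_spanning]).  As [rK2] has [2r] vertices, this gives
      [2r + o(r)].
    - For [r] fixed, [n = 64 r k / ln k] and [M = 2k]: half of the edges are met
      by the sets of at most [16rk/n] colours, so that [rho] is at least
      [k^(-1/2)], and [k log k] is negligible against [k^(3/2) / (log k)^2]
      ([forcing_few_vertices]).

    ** Lists defeated by stars.
    Conversely, give each colour a random vertex and colour every edge with a
    colour of its list whose vertex is an end of the edge.  Each colour class is
    a star and contains no [2K2].  An edge is left without colour with
    probability [(1-2/n)^k], so such a colouring exists once
    ['C(n, 2) (1-2/n)^k < 1], in particular for [n < k / ln k] and [k] large
    ([list_ramsey_obstruction]).  *)

(** * Matchings as involutions *)

Section TutteBerge.
Variables (T : finType) (e : rel T).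
Implicit Types (f : {ffun T -> T}) (X P S : {set T}).

(** A matching is encoded by the involution that exchanges the ends of its edges
    and fixes all other vertices.  Exchanging the edges of two matchings on a set
    of vertices is then a definition by cases, see [glue]. *)
Definition is_matching X f :=
  [forall x, (f (f x) == x) && ((f x != x) ==> (x \in X) && e x (f x))].

Definition covered f := [set x | f x != x].

(** Twice the matching number of the subgraph induced on [X]. *)
Definition max_covered X := \max_(f | is_matching X f) #|covered f|.

Lemma matchK X f : is_matching X f -> involutive f.
Proof. by move=> /forallP mf x; have /andP[/eqP] := mf x. Qed.

Lemma match_adj X f x : is_matching X f -> f x != x -> e x (f x).
Proof. by move=> /forallP mf fx; have /andP[_ /implyP/(_ fx)/andP[]] := mf x. Qed.

Lemma match_in X f x : is_matching X f -> f x != x -> x \in X.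
Proof. by move=> /forallP mf fx; have /andP[_ /implyP/(_ fx)/andP[]] := mf x. Qed.

Lemma match_moved X f x : is_matching X f -> (f (f x) != f x) = (f x != x).
Proof. by move=> mf; rewrite (matchK mf) eq_sym. Qed.

Lemma matchingP X f : involutive f ->
  (forall x, f x != x -> x \in X /\ e x (f x)) -> is_matching X f.
Proof.
move=> fK fe; apply/forallP => x; rewrite fK eqxx /=.
by apply/implyP => /fe[-> ->].
Qed.

Lemma sub_matching X (Y : {set T}) f : X \subset Y -> is_matching X f -> is_matching Y f.
Proof.
move=> XY mf; apply: matchingP; first exact: matchK mf.
by move=> x fx; rewrite (subsetP XY) ?(match_adj mf) // (match_in mf).
Qed.

Lemma id_matching X : is_matching X [ffun x => x].
Proof. by apply: matchingP => x; rewrite !ffunE // eqxx. Qed.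

Lemma covered_id : covered [ffun x => x] = set0.
Proof. by apply/setP => x; rewrite !inE ffunE eqxx. Qed.

Lemma covered_le_max X f : is_matching X f -> #|covered f| <= max_covered X.
Proof. exact: (@leq_bigmax_cond _ (is_matching X) (fun f => #|covered f|)). Qed.

Lemma max_covered_attained X : {f | is_matching X f & #|covered f| = max_covered X}.
Proof.
have h : 0 < #|[pred f | is_matching X f]|.
  by apply/card_gt0P; exists [ffun x => x]; rewrite inE id_matching.
have [f mf cf] := eq_bigmax_cond (fun f => #|covered f|) h.
by exists f; rewrite // -cf; apply: eq_bigl => g; rewrite inE.
Qed.

Definition glue P f1 f2 : {ffun T -> T} :=
  [ffun x => if x \in P then f1 x else f2 x].

Definition stable P f := forall x, x \in P -> f x \in P.

Lemma stable_out X P f x :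
  is_matching X f -> stable P f -> (f x \in P) = (x \in P).
Proof.
move=> mf sf; apply/idP/idP => [|/sf//]; by move=> /sf; rewrite (matchK mf).
Qed.

Lemma glue_matching X P f1 f2 : is_matching X f1 -> is_matching X f2 ->
  stable P f1 -> stable P f2 -> is_matching X (glue P f1 f2).
Proof.
move=> m1 m2 s1 s2; apply: matchingP => x; rewrite !ffunE.
  have [xP|xP] := boolP (x \in P); first by rewrite s1 // (matchK m1).
  by rewrite (stable_out x m2 s2) (negbTE xP) (matchK m2).
by case: ifP => xP fx; [rewrite (match_in m1 fx) (match_adj m1 fx)
                       |rewrite (match_in m2 fx) (match_adj m2 fx)].
Qed.

Lemma card_glue P f1 f2 : #|covered (glue P f1 f2)| =
  #|covered f1 :&: P| + #|covered f2 :\: P|.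
Proof.
rewrite -(cardsID P (covered _)); congr (_ + _); apply: eq_card => x;
  by rewrite !inE ffunE; case: (x \in P); rewrite ?andbF ?andbT.
Qed.

(** One end of each edge: this counts edges, and orients them. *)
Definition lower f := [set x | enum_rank x < enum_rank (f x)].

Lemma card_covered X f : is_matching X f -> #|covered f| = #|lower f|.*2.
Proof.
move=> mf; have fK := matchK mf.
have -> : covered f = lower f :|: f @: lower f.
  apply/setP => x; rewrite (can2_imset_pre _ fK fK) !inE fK.
  by rewrite -neq_ltn (inj_eq val_inj) (inj_eq enum_rank_inj) eq_sym.
rewrite cardsU disjoint_setI0 ?cards0 ?subn0; last first.
  rewrite -setI_eq0; apply/eqP/setP => x; rewrite (can2_imset_pre _ fK fK).
  by rewrite !inE fK; case: ltngtP.
by rewrite card_imset ?addnn //; apply: can_inj fK.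
Qed.

(** An edge avoiding [f] could be added to it; here the enlarged matching is
    obtained by gluing the transposition of [x] and [y]. *)
Lemma maximum_cover X f x y : symmetric e ->
  is_matching X f -> #|covered f| = max_covered X ->
  x \in X -> y \in X -> x != y -> e x y ->
  (x \in covered f) || (y \in covered f).
Proof.
move=> es mf cf xX yX xy exy; rewrite -[_ || _]negbK negb_or !inE !negbK.
apply/negP => /andP[/eqP fx /eqP fy].
pose P := [set x; y]; pose s : {ffun T -> T} := [ffun z => tperm x y z].
have ms : is_matching X s.
  apply: matchingP => z; rewrite !ffunE ?tpermK //.
  by case: tpermP => [->|->|]; rewrite ?eqxx // => _; rewrite ?xX ?yX // es.
have ss : stable P s by move=> z; rewrite !inE ffunE => /orP[]/eqP->;
  rewrite ?tpermL ?tpermR eqxx ?orbT.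
have sf : stable P f by move=> z; rewrite !inE => /orP[]/eqP->;
  rewrite ?fx ?fy eqxx ?orbT.
have := covered_le_max (glue_matching ms mf ss sf); rewrite card_glue.
have -> : covered s :&: P = P.
  apply/setP => z; rewrite !inE ffunE; case: (eqVneq z x) => [->|zx] /=.
    by rewrite tpermL eq_sym xy.
  by case: (eqVneq z y) => [->|]; rewrite ?tpermR ?xy ?andbF.
have -> : covered f :\: P = covered f.
  apply/setP => z; rewrite !inE; case: (eqVneq z x) => [->|zx] /=.
    by rewrite fx eqxx.
  by case: (eqVneq z y) => [->|] //=; rewrite fy eqxx.
rewrite cards2 xy cf; lia.
Qed.

(** * The Tutte-Berge formula *)

Section Alternating.
Variables (X : {set T}) (f1 f2 : {ffun T -> T}) (v : T).
Hypotheses (m1 : is_matching X f1) (m2 : is_matching X f2) (f2v : f2 v = v).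

(** Two steps along the path that starts at [v], which [f2] does not cover, and
    uses alternately the edges of [f1] and of [f2].  On the orbit of [v], [f1] and
    [f2] act as reflections of a cycle and [turn] as a rotation: the path itself
    need not be constructed. *)
Definition turn x := f2 (f1 x).
Definition alternating : {set T} := [set x | fconnect turn v x].

Let K1 := matchK m1.
Let K2 := matchK m2.

Lemma turn_inj : injective turn.
Proof. exact: inj_comp (can_inj K2) (can_inj K1). Qed.

(** [f2] conjugates [turn] to its inverse and fixes [v], so it maps the [i]-th
    point of the orbit of [v] to the point of index [-i]. *)
Lemma turn_back i : iter i turn (f2 (iter i turn v)) = v.
Proof.
elim: i => [//|i IH]; rewrite iterSr iterS /turn K2 K1 -/(turn _); exact: IH.
Qed.

Lemma alternating_stable2 : stable alternating f2.
Proof.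
move=> x; rewrite !inE => /iter_findex; move: (findex _ _ _) => i <-.
rewrite (fconnect_sym turn_inj).
by have := fconnect_iter turn i (f2 (iter i turn v)); rewrite turn_back.
Qed.

Lemma alternating_stable1 : stable alternating f1.
Proof.
move=> x xP; rewrite -[f1 x]K2; apply: alternating_stable2.
by move: xP; rewrite !inE -/(turn x) -same_fconnect1_r //; exact: turn_inj.
Qed.

(** [f1] maps the [i]-th point of the orbit to the point of index [-i-1].  A fixed
    point thus satisfies [2i+1 = 0] modulo the length of the orbit, and [2i+1] is
    less than twice this length. *)
Lemma alternating_fixed x : x \in alternating -> f1 x = x ->
  (findex turn v x).*2.+1 = order turn v.
Proof.
rewrite inE => xP f1x; set i := findex turn v x; set m := order turn v.
have im : i < m by apply: findex_max.
have xi : iter i turn v = x by apply: iter_findex.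
have per : iter i.*2.+1 turn v = v.
  have mirror : f2 (iter i.+1 turn v) = x by rewrite iterS xi /turn K2.
  by rewrite -addnn -addSn iterD xi -[RHS](turn_back i.+1) mirror.
have small p : p < m -> iter p turn v = v -> p = 0.
  by move=> pm pv; rewrite -(findex_iter pm) pv findex0.
have [lt|ge] := ltnP i.*2.+1 m; first by have := small _ lt per.
have/small: i.*2.+1 - m < m by lia.
move=> h; have: i.*2.+1 - m = 0; last by lia.
by apply: h; move: per; rewrite -{1}(subnK ge) iterD iter_order //; exact: turn_inj.
Qed.

(** The alternating path from [v] has only one other end. *)
Lemma alternating_uniq x y : x \in alternating -> y \in alternating ->
  f1 x = x -> f1 y = y -> x = y.
Proof.
move=> xP yP fx fy.
have := alternating_fixed yP fy; rewrite -(alternating_fixed xP fx).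
move=> [] /double_inj h.
by rewrite -(iter_findex (_ : fconnect turn v x)) -?h ?iter_findex //;
  move: xP yP; rewrite !inE.
Qed.

End Alternating.

Section Inessential.
Variable X : {set T}.

Definition maximum f := is_matching X f && (#|covered f| == max_covered X).

Hypothesis inessential : forall x, x \in X -> exists2 f, maximum f & f x = x.

(** The relation of Gallai's lemma.  Adjacent vertices are linked since a maximum
    matching cannot miss both. *)
Definition linked x y :=
  (x == y) || ~~ [exists f, [&& maximum f, f x == x & f y == y]].

Lemma linked_refl : reflexive linked.
Proof. by move=> x; rewrite /linked eqxx. Qed.

Lemma linked_sym : symmetric linked.
Proof.
move=> x y; rewrite /linked eq_sym; congr (_ || ~~ _).
by apply: eq_existsb => f; rewrite [X in _ && X]andbC.
Qed.

(** The other exchange, [f1] inside the path and [f2] outside, cannot exceed [f2];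
    hence on the path [f1] covers at most as many vertices as [f2]. *)
Lemma switch f1 f2 v : maximum f1 -> maximum f2 -> f2 v = v ->
  maximum (glue (alternating f1 f2 v) f2 f1).
Proof.
move=> /andP[m1 /eqP c1] /andP[m2 /eqP c2] fv.
have s1 := alternating_stable1 m1 m2 fv; have s2 := alternating_stable2 m1 m2 fv.
have mg := glue_matching m2 m1 s2 s1.
apply/andP; split=> //; rewrite eqn_leq covered_le_max //=.
have := covered_le_max (glue_matching m1 m2 s1 s2).
rewrite !card_glue; set P := alternating _ _ _.
have := cardsID P (covered f1); have := cardsID P (covered f2); lia.
Qed.

(** Suppose that [f1] is maximum and misses [u] and [w], and let [f2] be maximum
    and miss [v].  Switching [f1] along the path from [v] gives a maximum matching
    missing [v] and also whichever of [u] and [w] is off the path; both cannot be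
    on it, because [f1] misses only one vertex of the path. *)
Lemma linked_trans u v w :
  v \in X -> linked u v -> linked v w -> linked u w.
Proof.
move=> vX uv vw; rewrite /linked; case: eqVneq => //= uw.
apply/negP => /existsP[f1 /and3P[M1 /eqP fu /eqP fw]].
have [f2 M2 fv] := inessential vX.
have MG := switch M1 M2 fv.
have [m1 m2] : is_matching X f1 /\ is_matching X f2.
  by move: M1 M2 => /andP[-> _] /andP[].
set P := alternating f1 f2 v in MG.
have vP : v \in P by rewrite inE connect0.
have gv : glue P f2 f1 v = v by rewrite ffunE vP.
have out z : z \notin P -> f1 z = z -> ~~ linked v z.
  move=> zP fz; rewrite negb_or negbK; apply/andP; split.
    by apply: contraNneq zP => <-.
  by apply/existsP; exists (glue P f2 f1); rewrite MG gv eqxx ffunE (negbTE zP) fz /=.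
have uP : u \in P by apply: contraT => /out/(_ fu); rewrite linked_sym uv.
have wP : w \in P by apply: contraT => /out/(_ fw); rewrite vw.
by move: uw; rewrite (alternating_uniq m1 m2 fv uP wP fu fw) eqxx.
Qed.

Hypothesis es : symmetric e.

Lemma adj_linked x y : x \in X -> y \in X -> x != y -> e x y -> linked x y.
Proof.
move=> xX yX xy exy; rewrite /linked (negbTE xy) /=; apply/negP.
move=> /existsP[f /and3P[/andP[mf /eqP cf] fx fy]].
by have := maximum_cover es mf cf xX yX xy exy; rewrite !inE fx fy.
Qed.

(** The parts are the classes of [linked].  A maximum matching runs inside the
    classes and misses at most one vertex of each, so it has exactly [#|C|./2]
    edges inside the class [C]. *)
Lemma inessential_classes : exists Pt : {set {set T}},
  [/\ partition Pt X,
      {in X &, forall x y, x != y -> e x y ->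
         exists2 C, C \in Pt & (x \in C) && (y \in C)} &
      \sum_(C in Pt) #|C|./2.*2 <= max_covered X].
Proof.
have eqv : {in X & &, equivalence_rel linked}.
  move=> x y z xX yX zX; split; first exact: linked_refl.
  move=> xy; apply/idP/idP; last exact: linked_trans.
  by apply: linked_trans => //; rewrite linked_sym.
pose Pt := equivalence_partition linked X.
have part : partition Pt X by apply: equivalence_partitionP.
have same C x y : C \in Pt -> x \in C -> y \in X -> linked x y = (y \in C).
  move=> CP xC yX.
  have xX : x \in X by rewrite -(cover_partition part); apply/bigcupP; exists C.
  have -> : C = pblock Pt x by apply/esym/def_pblock => //; case/and3P: part.
  by rewrite pblock_equivalence_partition.
have adjC x y : x \in X -> y \in X -> x != y -> e x y ->
    exists2 C, C \in Pt & (x \in C) && (y \in C).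
  move=> xX yX xy exy.
  move: (xX); rewrite -{1}(cover_partition part) => /bigcupP[C CP xC].
  by exists C => //; rewrite xC -(same _ _ _ CP xC yX) adj_linked.
exists Pt; split=> //.
have [f mf cf] := max_covered_attained X.
have tI : trivIset Pt by case/and3P: part.
have -> : max_covered X = \sum_(C in Pt) #|covered f :&: C|.
  transitivity (\sum_(x in cover Pt | x \in covered f) 1).
    rewrite -cf (cover_partition part) -sum1_card; apply: eq_bigl => x.
    by rewrite andb_idl // inE; apply: match_in.
  rewrite big_trivIset_cond //; apply: eq_bigr => C _.
  by rewrite -sum1_card; apply: eq_bigl => x; rewrite !inE andbC.
apply: leq_sum => C CP.
(* Parity of [covered f :&: C] is needed for classes of even size: it holds
   because [f] restricted to [C] is again a matching. *)
have sC : stable C f.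
  move=> x xC; case: (eqVneq (f x) x) => [->//|fx].
  have fX : f x \in X by apply: (match_in mf); rewrite (match_moved _ mf).
  rewrite -(same _ _ _ CP xC fX); apply: adj_linked => //.
  - exact: match_in mf fx.
  - by rewrite eq_sym.
  exact: match_adj mf fx.
have := card_covered (glue_matching mf (id_matching X) sC
  (fun x xC => etrans (congr1 (mem C) (ffunE _ x)) xC)).
rewrite card_glue covered_id set0D cards0 addn0 => ev.
have := cardsID (covered f) C; rewrite setIC.
suff: #|C :\: covered f| <= 1 by lia.
apply/card_le1_eqP => x y; rewrite !inE !negbK => /andP[/eqP fx xC] /andP[/eqP fy yC].
have yX : y \in X by rewrite -(cover_partition part); apply/bigcupP; exists C.
have := same _ _ _ CP xC yX; rewrite yC /linked => /orP[/eqP->//|/negP[]].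
by apply/existsP; exists f; rewrite /maximum mf cf fx fy !eqxx.
Qed.

End Inessential.

(** Take [S] maximal such that deleting it lowers the matching number by [#|S|].
    Then no vertex outside [S] lies in all maximum matchings of the rest, since it
    could be added to [S]. *)
Theorem tutte_berge : symmetric e -> exists S (Pt : {set {set T}}),
  [/\ partition Pt (~: S),
      {in ~: S &, forall x y, x != y -> e x y ->
         exists2 C, C \in Pt & (x \in C) && (y \in C)} &
      #|S| + \sum_(C in Pt) #|C|./2 <= (max_covered setT)./2].
Proof.
move=> es.
pose ok S := max_covered (~: S) + #|S|.*2 <= max_covered setT.
have ok0 : ok set0 by rewrite /ok setC0 cards0 addn0.
have [S okS Smax] := arg_maxnP (fun S => #|S|) ok0.
have [|Pt [part adjC le]] := @inessential_classes (~: S) _ es.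
  move=> x; rewrite inE => xS.
  have [f mf cf] := max_covered_attained (~: (x |: S)).
  have sub : ~: (x |: S) \subset ~: S by rewrite setCS subsetUr.
  have mf' := sub_matching sub mf.
  have := Smax (x |: S); rewrite /ok cardsU1 xS /=.
  move=> h; have {h} : ~~ (#|covered f| + (1 + #|S|).*2 <= max_covered setT).
    by apply/negP => /[!cf]/h; lia.
  move: okS; rewrite /ok; have [g mg cg] := max_covered_attained (~: S).
  have := covered_le_max mf'; rewrite -cg.
  rewrite (card_covered mf') (card_covered mg) => l1 l2 l3.
  exists f; first by rewrite /maximum mf' -cg (card_covered mf') (card_covered mg); apply/eqP; lia.
  apply/eqP; apply: contraT => /(match_in mf).
  by rewrite !inE eqxx.
exists S, Pt; split => //.
have : \sum_(C in Pt) #|C|./2.*2 = (\sum_(C in Pt) #|C|./2).*2.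
  by rewrite -muln2 big_distrl /=; apply: eq_bigr => C _; rewrite muln2.
move: okS; rewrite /ok; lia.
Qed.

End TutteBerge.

(** * The Ramsey number of a matching *)

Lemma match_copy (T : finType) (e : rel T) X f r : symmetric e ->
  is_matching e X f -> r <= #|lower f| ->
  exists2 g : matching r -> T, injective g &
    forall u v, adj u v -> e (g u) (g v).
Proof.
move=> es mf rf; have fK := matchK mf.
pose h (i : 'I_r) : T := enum_val (widen_ord rf i).
have hi : injective h by move=> i j /enum_val_inj /(congr1 val)/= /val_inj.
have hl i : enum_rank (h i) < enum_rank (f (h i)).
  by have := enum_valP (widen_ord rf i); rewrite inE.
pose g (u : matching r) := if u.2 then f (h u.1) else h u.1.
have eh i : e (h i) (f (h i)).
  by apply: (match_adj mf); apply/eqP => hf; have := hl i; rewrite hf ltnn.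
exists g.
  have ne i j : f (h i) = h j -> False.
    by move=> E; have := hl i; have := hl j; rewrite -E fK; case: ltngtP.
  move=> [i [|]] [j [|]] /=; rewrite /g /=.
  - by move=> /(can_inj fK)/hi->.
  - by move=> /ne.
  - by move=> /esym/ne.
  - by move=> /hi->.
move=> [i a] [j b]; rewrite /adj /= /matching_adj /= => /andP[/eqP<-].
by rewrite /g /=; case: a; case: b => //= _; rewrite // es.
Qed.

Section Colour.
Variables (n : nat) (C : eqType) (c : Kedge n -> C).

Lemma edge_subproof (x y : 'I_n) : x != y -> #|[set x; y]| == 2.
Proof. by rewrite cards2 => ->. Qed.

Definition edge (x y : 'I_n) (xy : x != y) : Kedge n :=
  exist _ [set x; y] (edge_subproof xy).

Definition mono a : rel 'I_n :=
  fun x y => [exists e : Kedge n, (val e == [set x; y]) && (c e == a)].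

Lemma mono_sym a : symmetric (mono a).
Proof. by move=> x y; apply: eq_existsb => e; rewrite setUC. Qed.

Lemma mono_edge x y (xy : x != y) : mono (c (edge xy)) x y.
Proof. by apply/existsP; exists (edge xy); rewrite /= !eqxx. Qed.

Lemma max_covered_no_copy r a : ~ has_mono_copy (matching r) c ->
  (max_covered (mono a) setT)./2 < r.
Proof.
move=> nc; rewrite ltnNge; apply/negP => le; apply: nc.
have [f mf cf] := max_covered_attained (mono a) setT.
move: le; rewrite -cf (card_covered mf) doubleK => le.
have [g gi gadj] := match_copy (@mono_sym a) mf le.
exists g; split=> //; exists a => u v /gadj/existsP[e0 /andP[/eqP e0E /eqP <-]] e eE.
by congr c; apply: val_inj; rewrite eE e0E.
Qed.

End Colour.

(** Let [D] be the largest trace on [V] of a part, of colour [i0].  The pairs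
    between [D] and [V :\: D] are covered by parts [A] of other colours; if [A]
    meets these two sets in [p] and [q] points, then [p + q <= #|D|] and so
    [p * q <= #|D| * (p + q)./2].  Summing and dividing by [#|D|] bounds
    [#|V :\: D|] by the sum over the colours other than [i0], while
    [#|D| <= 1 + 2 * #|D|./2]. *)
Lemma clique_cover (T : finType) (k : nat) (V : {set T})
    (P : 'I_k -> {set {set T}}) (b : nat) :
  (forall i, trivIset (P i)) ->
  (forall i, \sum_(A in P i) #|A|./2 <= b) ->
  {in V &, forall x y, x != y ->
    exists i, exists2 A, A \in P i & (x \in A) && (y \in A)} ->
  #|V| <= 1 + b + \sum_i \sum_(A in P i) #|A|./2.
Proof.
move=> tI Pb cov; have [|V2] := leqP #|V| 1; first by lia.
have [x [y [xV yV xy]]] : exists x y, [/\ x \in V, y \in V & x != y].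
  have [x xV] : exists x, x \in V by apply/set0Pn; rewrite -card_gt0; lia.
  move: V2; rewrite (cardsD1 x) xV ltnS => /card_gt0P[y].
  by rewrite !inE => /andP[yx yV]; exists x, y; rewrite eq_sym.
have [i1 [A1 A1P /andP[xA _]]] := cov _ _ xV yV xy.
pose ok (q : 'I_k * {set T}) := q.2 \in P q.1.
have ok1 : ok (i1, A1) by [].
have [[i0 A0] /= A0P A0max] := arg_maxnP (fun q => #|q.2 :&: V|) ok1.
rewrite /ok /= in A0P.
set D := A0 :&: V; set W := V :\: D.
have maxD i A : A \in P i -> #|A :&: V| <= #|D|.
  by move=> AP; apply: (A0max (i, A)).
have D0 : 0 < #|D|.
  by apply: leq_trans (maxD _ _ A1P); apply/card_gt0P; exists x; rewrite inE xA.
have prod_le : #|D| * #|W| <=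
    \sum_(i | i != i0) \sum_(A in P i) #|A :&: D| * #|A :&: W|.
  have -> : #|D| * #|W| = \sum_(z in setX D W) 1 by rewrite sum1_card cardsX.
  have -> : \sum_(i | i != i0) \sum_(A in P i) #|A :&: D| * #|A :&: W| =
    \sum_(z in setX D W) \sum_(i | i != i0) \sum_(A in P i | (z.1 \in A) && (z.2 \in A)) 1.
    rewrite [RHS]exchange_big /=; apply: eq_bigr => i _.
    rewrite [RHS](exchange_big_dep (mem (P i))) /=; last by move=> z A _ /andP[].
    apply: eq_bigr => A AP; rewrite -cardsX -sum1_card; apply: eq_bigl => -[u v].
    by rewrite !in_setX !in_setI /= andbACA andbC AP.
  apply: leq_sum => -[u v]; rewrite !inE /= => /andP[/andP[uA uV] vDV].
  have {vDV}[vA vV] : v \notin A0 /\ v \in V.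
    by move: vDV => /andP[h vV]; move: h; rewrite vV andbT.
  have uv : u != v by apply: contraNneq vA => <-.
  have [i [A AP /andP[uA' vA']]] := cov _ _ uV vV uv.
  have ii : i != i0.
    apply: contraNneq vA => ii; move: AP; rewrite ii => AP.
    by rewrite -(def_pblock (tI i0) A0P uA) (def_pblock (tI i0) AP uA').
  rewrite (bigD1 i) //= (bigD1 A) /= ?AP ?uA' ?vA' //; lia.
have W_le : #|W| <= \sum_(i | i != i0) \sum_(A in P i) #|A|./2.
  rewrite -(leq_pmul2l D0); apply: leq_trans prod_le _.
  rewrite big_distrr /=; apply: leq_sum => i _.
  rewrite big_distrr /=; apply: leq_sum => A AP.
  have := maxD _ _ AP; have := subset_leq_card (subsetIl A V).
  have : #|A :&: V| = #|A :&: D| + #|A :&: W|.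
    rewrite -(cardsID D (A :&: V)) -setIA -setIDA.
    by rewrite (setIidPr (subsetIr A0 V : D \subset V)).
  move=> ->; move: #|A :&: D| #|A :&: W| #|A| #|D| => p q a d h1 h2.
  have [pq|qp] := leqP p q.
    rewrite mulnC; apply: leq_mul; lia.
  by apply: leq_mul; lia.
have VDW : #|V| = #|D| + #|W|.
  by rewrite -(cardsID D V) (setIidPr (subsetIr A0 V : D \subset V)).
have D_le : #|D|./2 <= \sum_(A in P i0) #|A|./2.
  rewrite (bigD1 A0) //=; apply: leq_trans (leq_addr _ _).
  exact: half_leq (subset_leq_card (subsetIl A0 V)).
have := Pb i0; rewrite (bigD1 i0) //= VDW.
move: D_le W_le; move: #|W| #|D| (\sum_(A in P i0) _) (\sum_(i | i != i0) _) => w d p q.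
lia.
Qed.

(** If [s i] vertices are deleted for colour [i], the parts of colour [i]
    contribute at most [r - 1 - s i] in [clique_cover], and its additional term is
    at most [r - 1]. *)
Lemma ramsey_matching_upper r k n (c : Kedge n -> 'I_k) :
  0 < r -> k.+1 * r.-1 + 1 < n -> has_mono_copy (matching r) c.
Proof.
move=> r0 nbig; apply: contrapT => nc.
have H i : exists q : {set 'I_n} * {set {set 'I_n}},
    [/\ partition q.2 (~: q.1),
        {in ~: q.1 &, forall x y, x != y -> mono c i x y ->
          exists2 A, A \in q.2 & (x \in A) && (y \in A)} &
        #|q.1| + \sum_(A in q.2) #|A|./2 <= r.-1].
  have [S [Pt [h1 h2 h3]]] := tutte_berge (mono_sym c i).
  exists (S, Pt); split=> //; apply: leq_trans h3 _.
  by have := max_covered_no_copy i nc; lia.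
have {H}[q Hq] := fin_all_exists H.
pose S := \bigcup_i (q i).1.
have VS : #|~: S| <= 1 + r.-1 + \sum_i \sum_(A in (q i).2) #|A|./2.
  apply: (@clique_cover _ k (~: S) (fun i => (q i).2) r.-1) => [i|i|x y].
  - by have [/and3P[]] := Hq i.
  - by have [_ _] := Hq i; lia.
  rewrite !inE => xS yS xy; exists (c (edge xy)).
  have [_ h _] := Hq (c (edge xy)); apply: h => //; last exact: mono_edge.
    by rewrite inE; apply: contra xS => h; apply/bigcupP; exists (c (edge xy)).
  by rewrite inE; apply: contra yS => h; apply/bigcupP; exists (c (edge xy)).
have SS : #|S| <= \sum_i #|(q i).1|.
  rewrite /S; elim/big_ind2: _ => [|A a B b|//]; first by rewrite cards0.
  move=> hA hB; rewrite cardsU; exact: leq_trans (leq_subr _ _) (leq_add hA hB).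
have tot : \sum_i (#|(q i).1| + \sum_(A in (q i).2) #|A|./2) <= k * r.-1.
  rewrite -[k in k * _]card_ord -sum_nat_const; apply: leq_sum => i _.
  by have [_ _] := Hq i.
move: tot nbig; rewrite big_split /= mulSn; have := cardsC S; rewrite card_ord.
move: VS SS; move: (\sum_i _) (\sum_i _) #|S| #|~: S| (k * _) => *; lia.
Qed.

Lemma mono_copy_edge r n (C : Type) (c : Kedge n -> C) :
  has_mono_copy (matching r) c ->
  exists (g : 'I_r * bool -> 'I_n) (a : C), injective g /\
    forall i, exists2 e : Kedge n, val e = [set g (i, false); g (i, true)] & c e = a.
Proof.
move=> [g [gi [a gadj]]]; exists g, a; split=> // i.
have ne : g (i, false) != g (i, true) by apply/eqP => /gi.
exists (edge ne) => //; apply: (gadj (i, false) (i, true)) => //.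
by rewrite /adj /= /matching_adj /= eqxx.
Qed.

(** Cut the vertices into [k+1] blocks of size [r-1], merge the first two, and
    colour an edge by the larger of the blocks of its ends.  The edges of a
    positive colour all meet a block of size [r-1]; those of colour 0 lie inside
    the merged block, which has less than [2r] vertices. *)
Lemma ramsey_matching_lower r k n : 0 < k -> 0 < r -> n <= k.+1 * r.-1 ->
  exists c : Kedge n -> 'I_k, ~ has_mono_copy (matching r) c.
Proof.
case: r => [|r] //= k0 _ nle.
(* The truncated predecessor merges the blocks 0 and 1. *)
pose b (x : 'I_n) := (x %/ r).-1.
have bk x : b x < k.
  have : x < k.+1 * r by apply: leq_trans (ltn_ord x) nle.
  rewrite /b; have [->|r0] := posnP r; first by rewrite muln0.
  by rewrite -ltn_divLR //; lia.
have ck (e : Kedge n) : \max_(x in val e) b x < k.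
  by elim/big_ind: _ => // p q pk qk; rewrite gtn_max pk qk.
exists (fun e => Ordinal (ck e)) => /mono_copy_edge[g [a [gi ga]]].
have [a0|a0] := posnP a.
  have small u : g u < 2 * r.
    have : b (g u) = 0.
      apply/eqP; rewrite -leqn0; case: u => i t; have [e eE /(congr1 val)/=] := ga i.
      rewrite a0 => <-; apply: (@leq_bigmax_cond _ (mem (val e)) b).
      by rewrite /= eE !inE; case: t; rewrite eqxx ?orbT.
    rewrite /b; have [r0|r0] := posnP r.
      by have := ltn_ord (g u); move: nle; rewrite r0 muln0; lia.
    by have := ltn_divLR (g u) 2 r0; lia.
  have := leq_card (fun u => Ordinal (small u)) (_ : injective _).
  rewrite card_prod card_bool !card_ord => /(_ _)/wrap[]; last by lia.
  by move=> u v /(congr1 val)/= /val_inj /gi.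
have pick i : exists t, b (g (i, t)) = a.
  have [e eE /(congr1 val)/= cE] := ga i.
  have [|x xe xE] := @eq_bigmax_cond _ (mem (val e)) b.
    by rewrite (eqP (valP e)).
  have {xE}xa : b x = a by rewrite -cE -xE.
  move: xe; rewrite inE /= eE !inE => /orP[]/eqP h; rewrite h in xa.
    by exists false.
  by exists true.
have [t tE] := fin_all_exists pick.
have r0 : 0 < r.
  have div0 m : r = 0 -> m %/ r = 0 by move=> ->; rewrite divn0.
  by have [/div0 rr|//] := posnP r; have := tE ord0; rewrite /b rr; lia.
have := leq_card (fun i => Ordinal (ltn_pmod (g (i, t i)) r0)) (_ : injective _).
rewrite !card_ord => /(_ _)/wrap[]; last by rewrite ltnn.
move=> i j /(congr1 val)/= E.
have /gi[] // : g (i, t i) = g (j, t j).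
apply: val_inj; rewrite /= (divn_eq (g (i, t i)) r) (divn_eq (g (j, t j)) r) E.
by have := tE i; have := tE j; rewrite /b; lia.
Qed.

(** * Lists forcing a monochromatic matching *)

(** The union bound for a uniformly random [L]: the event [i] asks all the
    independent coordinates [L x] to be bad, and the hypothesis says that the
    probabilities of these events sum to less than one. *)
Lemma union_bound (I E C : finType) (bad : I -> E -> pred C) :
  \sum_i \prod_x #|bad i x| < #|C| ^ #|E| ->
  exists L : {ffun E -> C}, forall i, exists x, ~~ bad i x (L x).
Proof.
move=> small.
suff [L /forallP HL] : exists L : {ffun E -> C}, [forall i, L \notin family (bad i)].
  exists L => i; have := HL i; rewrite inE => /forallPn[x xP]; by exists x.
apply/existsP; apply: contraTT small => /existsPn all_bad.
rewrite -leqNgt -card_ffun -sum1_card.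
have -> : \sum_i \prod_x #|bad i x| = \sum_(L : {ffun E -> C}) \sum_(i | L \in family (bad i)) 1.
  rewrite (exchange_big_dep predT) //=; apply: eq_bigr => i _.
  rewrite sum1_card -[LHS](_ : #|family (bad i)| = _) //.
  by rewrite card_family foldrE big_image.
apply: leq_sum => L _; have /forallPn[i] := all_bad L.
by rewrite negbK => Li; rewrite (bigD1 i).
Qed.

Lemma card_kset_sub (T : finType) k (B : {set T}) :
  #|[pred A : {A : {set T} | #|A| == k} | val A \subset B]| = 'C(#|B|, k).
Proof.
rewrite -cards_draws -(card_image val_inj); apply: eq_card => A; rewrite inE.
apply/imageP/andP => [[S SB ->]|[AB Ak]]; first by split; [exact: SB|exact: (valP S)].
by exists (exist _ A Ak).
Qed.

Lemma card_kset (T : finType) k : #|{: {A : {set T} | #|A| == k}}| = 'C(#|T|, k).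
Proof.
rewrite -cardsT -card_kset_sub; apply: eq_card => A; by rewrite !inE subsetT.
Qed.

Lemma card_Kedge n : #|{: Kedge n}| = 'C(n, 2).
Proof. by rewrite card_kset card_ord. Qed.

Section Cover.
Variables (n M : nat) (D : 'I_M -> {set 'I_n}).

Definition covering (e : Kedge n) := [set i | ~~ [disjoint val e & D i]].

(** Markov's inequality for the incidences between colours and edges: each set
    [D i] avoids at least ['C(n - r, 2)] edges. *)
Lemma few_heavy_edges r d : (forall i, #|D i| <= r) ->
  d.+1 * #|[pred e | d < #|covering e|]| <= M * ('C(n, 2) - 'C(n - r, 2)).
Proof.
move=> Dr.
apply: (@leq_trans (\sum_e #|covering e|)).
  rewrite mulnC -sum_nat_const [leqRHS](bigID [pred e | d < #|covering e|]) /=.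
  by apply: leq_trans (leq_addr _ _); apply: leq_sum.
have -> : \sum_e #|covering e| = \sum_(i < M) #|[pred e : Kedge n | i \in covering e]|.
  under eq_bigr => e _ do rewrite -sum1_card.
  rewrite (exchange_big_dep predT) //=.
  by apply: eq_bigr => i _; rewrite sum1_card.
rewrite -[X in X * _]card_ord -sum_nat_const; apply: leq_sum => i _.
rewrite leq_subRL ?leq_bin2l ?leq_subr //.
have := cardC [pred e | i \in covering e].
rewrite card_Kedge addnC => <-; rewrite leq_add2r.
have -> : #|[predC [pred e | i \in covering e]]| = #|[pred e : Kedge n | val e \subset ~: D i]|.
  by apply: eq_card => e; rewrite !inE negbK disjoints_subset.
by rewrite card_kset_sub leq_bin2l // cardsCs setCK card_ord leq_sub2l.
Qed.

End Cover.

(** Take the vertices met by a maximum matching of colour [a]: an edge of this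
    colour avoiding them could be added to the matching. *)
Lemma no_copy_cover n (C : eqType) (c : Kedge n -> C) r a :
  ~ has_mono_copy (matching r) c ->
  exists2 D : {set 'I_n}, #|D| <= r.*2 &
    forall e, c e = a -> ~~ [disjoint val e & D].
Proof.
move=> nc; have [f mf cf] := max_covered_attained (mono c a) setT.
exists (covered f).
  by have := max_covered_no_copy a nc; rewrite -cf (card_covered mf); lia.
move=> e ce; have /cards2P[x [y [xy eE]]] := valP e.
have m : mono c a x y by apply/existsP; exists e; rewrite eE ce !eqxx.
have := maximum_cover (@mono_sym _ _ c a) mf cf (in_setT x) (in_setT y) xy m.
rewrite eE -setI_eq0; case/orP => h; apply/set0Pn; [exists x|exists y].
  by rewrite !inE eqxx; rewrite inE in h.
by rewrite !inE eqxx orbT; rewrite inE in h.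
Qed.

Lemma set_in_codom n m (D : {set 'I_n}) : 0 < n -> #|D| <= m ->
  exists g : {ffun 'I_m -> 'I_n}, D \subset codom g.
Proof.
move=> n0 Dm; exists [ffun j : 'I_m => nth (Ordinal n0) (enum D) j].
apply/subsetP => x xD; have xi : index x (enum D) < #|D|.
  by rewrite cardE index_mem mem_enum.
apply/codomP; exists (Ordinal (leq_trans xi Dm)).
by rewrite ffunE nth_index ?mem_enum.
Qed.

Definition forcing r k n : Prop :=
  exists L : Kedge n -> {fset nat}, (forall e, #|` L e| = k) /\
    forall c, list_colouring L c -> has_mono_copy (matching r) c.

(** A random list of [k] among [M] colours avoids [d] given colours with
    probability ['C(M - d, k) / 'C(M, k)].  By [few_heavy_edges] the third
    hypothesis provides, for every family of [M] covers, at least [E0] edges that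
    are met by at most [d] of them; the last one is the union bound over the
    families.  Covers are represented by functions from ['I_(r.*2)], so that there
    are [n ^ (r.*2 * M)] families. *)
Lemma list_ramsey_criterion n M k r d E0 :
  0 < n -> E0 <= 'C(n, 2) ->
  M * ('C(n, 2) - 'C(n - r.*2, 2)) <= d.+1 * ('C(n, 2) - E0) ->
  n ^ (r.*2 * M) * ('C(M, k) - 'C(M - d, k)) ^ E0 < 'C(M, k) ^ E0 ->
  forcing r k n.
Proof.
move=> n0 E0N light count.
pose K := {A : {set 'I_M} | #|A| == k}.
have cK : #|{: K}| = 'C(M, k) by rewrite card_kset card_ord.
pose F := {ffun 'I_M -> {ffun 'I_(r.*2) -> 'I_n}}.
pose D (f : F) i : {set 'I_n} := [set x in codom (f i)].
pose bad (f : F) (e : Kedge n) (A : K) := ~~ [disjoint val A & covering (D f) e].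
have card_bad f e :
    #|bad f e| = 'C(M, k) - 'C(M - #|covering (D f) e|, k).
  rewrite -cK -(cardC (bad f e)).
  suff -> : 'C(M - #|covering (D f) e|, k) = #|[predC bad f e]| by rewrite addnK.
  have -> : M - #|covering (D f) e| = #|~: covering (D f) e|.
    by rewrite [RHS]cardsCs setCK card_ord.
  rewrite -card_kset_sub; apply: eq_card => A.
  by rewrite !inE negbK disjoints_subset.
have [|L HL] := @union_bound F (Kedge n) K bad.
  set x := 'C(M, k) - 'C(M - d, k) in count.
  set y := 'C(M, k) in count.
  have xy : x <= y by apply: leq_subr.
  have y0 : 0 < y.
    rewrite lt0n; apply: contraTneq count => y0.
    rewrite -leqNgt (_ : x = 0) ?y0; last by lia.
    by rewrite leq_pmull // expn_gt0 n0.
  have prod_le f : \prod_e #|bad f e| <= x ^ E0 * y ^ ('C(n, 2) - E0).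
    pose heavy := [pred e | d < #|covering (D f) e|].
    have hN : #|heavy| <= 'C(n, 2) - E0.
      rewrite -(@leq_pmul2l d.+1) //; apply: leq_trans light.
      apply: few_heavy_edges => i; rewrite cardsE.
      by apply: leq_trans (leq_image_card _ _) _; rewrite card_ord.
    have hC := cardC heavy; rewrite card_Kedge in hC.
    rewrite (bigID heavy) /=.
    apply: (@leq_trans (y ^ #|heavy| * x ^ #|[predC heavy]|)).
      rewrite -!prod_nat_const; apply: leq_mul; apply: leq_prod => e.
        by rewrite card_bad leq_subr.
      rewrite -leqNgt => he; rewrite card_bad leq_sub2l // leq_bin2l //.
      exact: leq_sub2l.
    have -> : #|[predC heavy]| = E0 + ('C(n, 2) - E0 - #|heavy|).
      move: hC hN E0N; move: #|heavy| #|[predC heavy]| => h l; lia.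
    rewrite expnD mulnCA leq_mul2l; apply/orP; right.
    rewrite -[in leqRHS](subnKC hN) expnD leq_mul2l; apply/orP; right.
    by case: (posnP ('C(n, 2) - E0 - #|heavy|)) => [->//|h0]; rewrite leq_exp2r.
  apply: (@leq_ltn_trans (\sum_(f : F) x ^ E0 * y ^ ('C(n, 2) - E0))).
    exact: leq_sum.
  rewrite sum_nat_const cK card_Kedge !card_ffun !card_ord -expnM mulnA.
  rewrite -[in ltnRHS](subnKC E0N) expnD ltn_pmul2r //.
  by rewrite expn_gt0 y0.
exists (fun e => [fset val i | i in val (L e)]%fset); split.
  move=> e; rewrite card_imfset /=; last exact: val_inj.
  by rewrite -cardE; apply/eqP/(valP (L e)).
move=> c cL; apply: contrapT => nc.
have H (i : 'I_M) : exists g : {ffun 'I_(r.*2) -> 'I_n},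
    forall e, c e = i -> ~~ [disjoint val e & [set x in codom g]].
  have [D0 D0r Dcov] := no_copy_cover (val i) nc.
  have [g Dg] := set_in_codom n0 D0r.
  exists g => e /Dcov; apply: contra; apply: disjointWr.
  by apply/subsetP => x /(subsetP Dg); rewrite inE.
have [f Hf] := fin_all_exists H.
have [e] := HL (finfun f); rewrite negbK => dis.
have /imfsetP[i /= iL ceq] := cL e.
have := Hf i e ceq; apply/negP; rewrite negbK.
have := disjointFr dis iL; rewrite inE => /negbFE.
by rewrite /D ffunE.
Qed.

(** * Lists defeated by stars *)

Lemma card_fset_ord m (A : {fset nat}) : (forall i, i \in A -> i < m) ->
  #|[pred i : 'I_m | val i \in A]| = #|` A|.
Proof.
move=> Am; rewrite cardE -(size_map val); apply/perm_size/uniq_perm.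
- by rewrite (map_inj_uniq val_inj) enum_uniq.
- exact: fset_uniq.
move=> i; apply/mapP/idP => [[j]|iA]; first by rewrite mem_enum => jA ->.
by exists (Ordinal (Am _ iA)); rewrite ?mem_enum.
Qed.

(** The random choice is that of the vertices [v i], the event to avoid for the
    edge [e] being that no colour of its list has its vertex in [e]. *)
Lemma star_colouring n k (L : Kedge n -> {fset nat}) : 0 < n ->
  (forall e, #|` L e| = k) -> 'C(n, 2) * (n - 2) ^ k < n ^ k ->
  exists (c : Kedge n -> nat) (v : nat -> 'I_n),
    list_colouring L c /\ forall e, v (c e) \in val e.
Proof.
move=> n0 Lk count.
(* Any bound on the colours occurring in the lists will do. *)
pose m := (\max_(e : Kedge n) \sum_(i <- L e) i).+1.
have Lm e i : i \in L e -> i < m.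
  move=> iL; rewrite ltnS; apply: leq_trans (leq_bigmax e).
  by rewrite (big_rem i) //= leq_addr.
pose bad (e : Kedge n) (i : 'I_m) (x : 'I_n) := (val i \in L e) ==> (x \notin val e).
have [|f Hf] := @union_bound (Kedge n) 'I_m 'I_n bad.
  have pr e : \prod_i #|bad e i| = (n - 2) ^ k * n ^ (m - k).
    pose A := [pred i : 'I_m | val i \in L e].
    have Ak : #|A| = k by rewrite card_fset_ord // => i; apply: Lm.
    have AC : #|[predC A]| = m - k.
      by have := cardC A; rewrite card_ord Ak; move: #|[predC A]| => l; lia.
    rewrite -[in n ^ (m - k)]AC -[in (n - 2) ^ k]Ak -!prod_nat_const (bigID A) /=.
    congr (_ * _); apply: eq_bigr => i iA.
      have : #|bad e i| = #|~: val e|.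
        by apply: eq_card => x; rewrite !inE /bad unfold_in iA.
      by move=> ->; rewrite cardsCs setCK card_ord (eqP (valP e)).
    rewrite -[RHS]card_ord; apply: eq_card => x.
    by rewrite unfold_in /bad (negbTE iA).
  rewrite (eq_bigr _ (fun e _ => pr e)) sum_nat_const card_Kedge mulnA !card_ord.
  have [km|km] := leqP k m.
    by rewrite -[in ltnRHS](subnKC km) expnD ltn_pmul2r // expn_gt0 n0.
  case: (posnP #|{: Kedge n}|) => [|/card_gt0P[e _]].
    by rewrite card_Kedge => ->; rewrite !mul0n expn_gt0 n0.
  have := max_card [pred i : 'I_m | val i \in L e].
  by rewrite card_fset_ord ?Lk ?card_ord; [lia | exact: Lm].
have H e : exists i : 'I_m, (val i \in L e) && (f i \in val e).
  by have [i] := Hf e; rewrite /bad negb_imply negbK; exists i.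
have [c Hc] := fin_all_exists H.
exists (fun e => val (c e)), (fun i => f (inord i)); split=> e.
  by have /andP[] := Hc e.
by rewrite inord_val; have /andP[] := Hc e.
Qed.

(** Two disjoint edges of the same colour would share the vertex of this colour. *)
Lemma list_ramsey_obstruction n k r (L : Kedge n -> {fset nat}) : 0 < n -> 2 <= r ->
  (forall e, #|` L e| = k) -> 'C(n, 2) * (n - 2) ^ k < n ^ k ->
  exists2 c, list_colouring L c & ~ has_mono_copy (matching r) c.
Proof.
move=> n0 r2 Lk count; have [c [v [cL vc]]] := star_colouring n0 Lk count.
exists c => // /mono_copy_edge[g [a [gi ga]]].
have end_ i : exists t, v a = g (i, t).
  have [e eE ce] := ga i; have := vc e; rewrite ce eE !inE.
  by case/orP => /eqP->; [exists false|exists true].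
have r0 : 0 < r by lia.
have [t0 E0] := end_ (Ordinal r0); have [t1] := end_ (Ordinal r2).
by rewrite E0 => /gi [].
Qed.

(** * Bounds on the two Ramsey numbers *)

Lemma list_ramsey_le r k n : forcing r k n -> list_ramsey (matching r) k <= n.
Proof.
by move=> Ln; apply: (smallestP (P := forcing r k) _).2 => //; exists n.
Qed.

Lemma list_ramsey_ind r k (Q : nat -> Prop) : (exists n, forcing r k n) ->
  (forall n, forcing r k n -> Q n) -> Q (list_ramsey (matching r) k).
Proof. by move=> /smallestP[fn _]; apply. Qed.

Lemma matching_size n C (c : Kedge n -> C) r :
  has_mono_copy (matching r) c -> 2 * r <= n.
Proof.
by move=> [g [/leq_card + _]]; rewrite card_prod card_bool !card_ord mulnC.
Qed.

Lemma forcing_size r k n : 0 < k -> forcing r k n -> 2 * r <= n.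
Proof.
move=> k0 [L [Lk LP]]; have H e : exists i, i \in L e.
  by apply/fset0Pn; rewrite -cardfs_gt0 Lk.
by have [c Hc] := fin_all_exists H; apply: matching_size (LP c Hc).
Qed.

Lemma ramsey_bounds r k : 0 < k -> 0 < r ->
  k.+1 * r.-1 < ramsey (matching r) k <= k.+1 * r.-1 + 2.
Proof.
move=> k0 r0; pose P n := forall c : Kedge n -> 'I_k, has_mono_copy (matching r) c.
have PU : P (k.+1 * r.-1 + 2).
  by move=> c; apply: ramsey_matching_upper => //; lia.
have [Pm mmin] : P (ramsey (matching r) k) /\ _ := smallestP (ex_intro _ _ PU).
rewrite mmin // andbT ltnNge; apply/negP => le.
by have [c []] := ramsey_matching_lower k0 r0 le; apply: Pm.
Qed.

(** * Numerical estimates *)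

Section Exponentials.
Variable R : realType.
Local Open Scope ring_scope.
Implicit Types (x y z c : R).

Lemma expR_ge_sqr y : 0 <= y -> y ^+ 2 / 2 <= expR y.
Proof.
by move=> y0; apply: le_trans (expR_ge1Dxn 1 y0); rewrite lerDr ler01.
Qed.

(** With [y = ln x], the bound [y ^+ 2 / 2 <= x] gives [ln x <= c * x] as soon as
    [2 / c ^+ 2 <= x]. *)
Lemma ln_le_lin c x : 0 < c -> 2 / c ^+ 2 <= x -> ln x <= c * x.
Proof.
move=> c0 cx; have c20 : 0 < c ^+ 2 by rewrite exprn_gt0.
have x0 : 0 < x by apply: lt_le_trans cx; rewrite divr_gt0.
have [xn|xp] := lerP (ln x) 0; first by apply: le_trans xn _; nra.
have := @expR_ge_sqr (ln x) (ltW xp); rewrite lnK ?posrE // => h.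
rewrite leNgt; apply/negP => lt.
have : (c * x) ^+ 2 < ln x ^+ 2 by rewrite ltr_pXn2r // nnegrE; nra.
have : 2 <= c ^+ 2 * x by rewrite mulrC -ler_pdivrMr.
rewrite exprMn; nra.
Qed.

(** The union bounds reduce to this form, by [1 - z <= expR (- z)] with
    [z = b / B]. *)
Lemma exp_count (n a b B E : nat) : (0 < n)%N -> (0 < B)%N -> (b <= B)%N ->
  a%:R * ln n%:R < E%:R * (b%:R / B%:R) :> R ->
  (n ^ a * (B - b) ^ E < B ^ E)%N.
Proof.
move=> n0 B0 bB lt.
have nR : 0 < n%:R :> R by rewrite ltr0n.
have BR : 0 < B%:R :> R by rewrite ltr0n.
rewrite -(ltr_nat R) natrM !natrX natrB //.
set z : R := b%:R / B%:R in lt.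
have -> : B%:R - b%:R = B%:R * (1 - z) :> R by rewrite /z; field; rewrite gt_eqF.
rewrite exprMn mulrCA gtr_pMr ?exprn_gt0 //.
have z1 : 0 <= 1 - z by rewrite subr_ge0 /z ler_pdivrMr // mul1r ler_nat.
have ze : 1 - z <= expR (- z) by apply: expR_ge1Dx.
apply: (@le_lt_trans _ _ (n%:R ^+ a * expR (- z) ^+ E)).
  by apply: ler_wpM2l; [rewrite exprn_ge0 // ltW|rewrite lerXn2r // nnegrE expR_ge0].
rewrite -{1}(lnK nR) -!expRM_natl -expRD expR_lt1; lra.
Qed.

Lemma one_sub_ge_exp z : 0 <= z -> z <= 2^-1 -> expR (- (2 * z)) <= 1 - z.
Proof.
move=> z0 z1; have h := expR_ge1Dx (2 * z); have e0 := expR_gt0 (2 * z).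
rewrite expRN -[leLHS]mul1r ler_pdivrMr //.
apply: le_trans (ler_wpM2l _ h); [nra|lra].
Qed.

End Exponentials.

Lemma bin2_double n : 'C(n, 2).*2 = n * n.-1.
Proof. by have := mul_bin_diag n 1; rewrite bin1 mul2n. Qed.

Lemma half_compl m : m.*2 <= 4 * (m - m./2).
Proof. lia. Qed.

Lemma half_bin2_ge n : 4 <= n -> n ^ 2 <= 16 * 'C(n, 2)./2.
Proof.
move=> n4; have := bin2_double n; rewrite -mulnn.
have n2 : n * n = n * n.-1 + n by rewrite -mulnSr prednK //; lia.
have n3 : 4 * n <= n * n by rewrite leq_mul2r n4 orbT.
lia.
Qed.

Lemma bin2_sub n s : 0 < s -> s <= n -> 'C(n, 2) - 'C(n - s, 2) <= s * n.-1.
Proof.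
case: s => [//|s] _ sn; rewrite -{1 3}(subnK sn); move: (n - s.+1) => m.
have := bin2_double (m + s.+1); have := bin2_double m.
have -> : (m + s.+1) * (m + s.+1).-1 = m * m.-1 + 2 * (s.+1 * m) + s.+1 * s.
  by rewrite addnS /=; case: m => [|m] /=; lia.
have -> : s.+1 * (m + s.+1).-1 = s.+1 * m + s.+1 * s by rewrite addnS /= mulnDr.
lia.
Qed.

Lemma ffact_ratio M d a k : a + k <= M.+1 ->
  M ^_ k * (a - d) ^ k <= (M - d) ^_ k * a ^ k.
Proof.
elim: k => [|k IH] ak; first by rewrite !ffactn0 !expn0.
rewrite !ffactnSr !expnSr mulnACA [leqRHS]mulnACA.
apply: leq_mul; first by apply: IH; lia.
rewrite subnAC; have : a <= M - k by lia.
move: (M - k) => m am; have [da|/ltnW da] := leqP a d.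
  by rewrite (_ : a - d = 0) ?muln0 //; lia.
rewrite mulnBr mulnBl; apply: leq_sub2l; by rewrite mulnC leq_mul.
Qed.

(** Factor by factor, [(M - d - j) / (M - j) >= (a - d) / a] for [a <= M - j]. *)
Lemma bin_ratio M d a k : a + k <= M.+1 ->
  'C(M, k) * (a - d) ^ k <= 'C(M - d, k) * a ^ k.
Proof.
move=> ak; rewrite -(leq_pmul2r (fact_gt0 k)).
by rewrite mulnAC bin_ffact [leqRHS]mulnAC bin_ffact ffact_ratio.
Qed.

Section Forcing.
Variable R : realType.
Local Open Scope ring_scope.

(** Write [w = r / q], [n = 2r + w], [N = 'C(n, 2)] and [W = 'C(w, 2)].  Each cover
    avoids at least [W] edges, and [N <= 72 q^2 W].  With [M = 144 k q^2] colours
    the edges avoided by at least [k] covers number at least [W / 2], and each of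
    them has its list among these colours with probability at least the constant
    [1 / 'C(M, k)]. *)
Lemma forcing_nearly_spanning k q : (0 < k)%N -> (0 < q)%N ->
  exists r0, forall r, (r0 <= r)%N ->
    forcing r k (2 * r + r %/ q).
Proof.
move=> k0 q0; pose M := (144 * k * q ^ 2)%N; pose B := 'C(M, k).
(* [1 / T] is the slope allowed for [ln n] in the union bound, where the factor
   1000 exceeds [16 * 24]. *)
pose T := (1000 * M * q ^ 2 * B)%N.
have q2 : (0 < q ^ 2)%N by rewrite expn_gt0 q0.
have kM : (k <= M)%N by rewrite /M; nia.
have B0 : (0 < B)%N by rewrite bin_gt0.
have M0 : (0 < M)%N by lia.
have T0 : (0 < T)%N by rewrite /T muln_gt0 B0 muln_gt0 q2 muln_gt0 M0.
exists (2 * T ^ 2 + 4 * q)%N => r rbig.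
set w := (r %/ q)%N; set n := (2 * r + w)%N; set W := 'C(w, 2).
have w4 : (4 <= w)%N by rewrite leq_divRL //; lia.
have rw : (r <= 2 * q * w)%N.
  have := ltn_ceil r q0; rewrite -/w; nia.
have wr : (w <= r)%N by apply: leq_div.
have W2 : (W.*2 = w * w.-1)%N := bin2_double w.
have N2 : ('C(n, 2).*2 = n * n.-1)%N := bin2_double n.
have nw : (n <= 6 * q * w)%N by rewrite /n; nia.
have NW : ('C(n, 2) <= 72 * q ^ 2 * W)%N.
  have h1 : (n * n.-1 <= (6 * q * w) * (6 * q * w))%N.
    by apply: leq_mul => //; apply: leq_trans nw; apply: leq_pred.
  have h2 : (q ^ 2 * (w * w) <= q ^ 2 * (2 * (w * w.-1)))%N.
    by rewrite leq_mul2l mulnCA leq_mul2l; apply/orP; right; apply/orP; right; lia.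
  move: h1 h2; rewrite -W2 -N2 -!mulnn; lia.
have WN : (W <= 'C(n, 2))%N by apply: leq_bin2l; rewrite /n; lia.
apply: (@list_ramsey_criterion n M k r (M - k) W./2).
- rewrite /n; lia.
- lia.
- have -> : (n - r.*2 = w)%N by rewrite /n; lia.
  rewrite -/W; set N := 'C(n, 2) in NW WN *; set h := W./2.
  have hW : (h.*2 <= W)%N by rewrite /h; lia.
  have h1 : (M * (N - W) + M * (W - h) = M * (N - h))%N by rewrite -mulnDr; congr (_ * _)%N; lia.
  have h2 : (k * (N - h) <= M * (W - h))%N.
    have -> : M = (k * (144 * q ^ 2))%N by rewrite /M; lia.
    rewrite -mulnA leq_mul2l; apply/orP; right; apply: leq_trans (leq_subr _ _) _.
    apply: leq_trans NW _; have W2h : (W <= 2 * (W - h))%N by lia.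
    by apply: leq_trans (leq_mul (leqnn (72 * q ^ 2)%N) W2h) _; rewrite mulnA; lia.
  have h3 : ((M - k) * (N - h) + k * (N - h) = M * (N - h))%N by rewrite -mulnDl subnK.
  rewrite mulSn; lia.
rewrite subKn // binn; apply: (@exp_count R) => //; first by rewrite /n; lia.
have lnn : ln (n%:R : R) <= T%:R^-1 * n%:R.
  apply: ln_le_lin; first by rewrite invr_gt0 ltr0n.
  rewrite exprVn invrK -natrX -natrM ler_nat /n; lia.
set h := W./2.
have hw : (w * w <= 16 * h)%N by rewrite mulnn half_bin2_ge.
apply: (@le_lt_trans _ _ ((r.*2 * M)%:R * (T%:R^-1 * n%:R))).
  by rewrite ler_wpM2l.
rewrite mulrCA mulrC ltr_pdivrMr ?ltr0n // mulrA mulr1 mulrAC ltr_pdivlMr ?ltr0n //.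
rewrite -!natrM ltr_nat.
have h1 : (r * n <= (2 * q * w) * (6 * q * w))%N by apply: leq_mul.
have h2 : (r * n * (M * B) <= 12 * (w * w) * (q ^ 2 * (M * B)))%N.
  apply: leq_trans (leq_mul h1 (leqnn (M * B))) _; rewrite -mulnn; lia.
have h3 : (w * w * (q ^ 2 * (M * B)) <= 16 * h * (q ^ 2 * (M * B)))%N by apply: leq_mul.
have h4 : (0 < w * w * (q ^ 2 * (M * B)))%N.
  by rewrite muln_gt0 [X in _ && X]muln_gt0 q2 [X in _ && X]muln_gt0 M0 B0 andbT muln_gt0; lia.
have -> : (r.*2 * M * n * B = 2 * (r * n * (M * B)))%N by rewrite -mul2n; lia.
have -> : (h * T = 1000 * (h * (q ^ 2 * (M * B))))%N by rewrite /T; lia.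
lia.
Qed.

(** With [n] about [64 r k / ln k] and [M = 2k] colours, an edge is met on average
    by at most [4 r M / n = 8 r k / n] covers, so that half of the edges are met
    by at most [d = 16 r k / n].  For these the list avoids the covers with
    probability at least [(1 - 16 r / n)^k], which is at least
    [expR (- 32 r k / n)] and therefore at least [k^(-1/2)]. *)
Lemma forcing_few_vertices r k : (0 < r)%N -> 128 * r%:R + 64 <= ln k%:R :> R ->
  exists2 n, n%:R <= 65 * r%:R * (k%:R / ln k%:R) :> R & forcing r k n.
Proof.
move=> r0; set y : R := ln k%:R => yr.
have r1 : 1 <= r%:R :> R by rewrite (ler_nat R 1).
have y0 : 0 < y by lra.
have k0 : 0 < k%:R :> R.
  by rewrite ltr0n lt0n; apply: contraTneq y0 => k0; rewrite /y k0 ln0 ?ltxx.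
have ky : k%:R = expR y by rewrite lnK.
set x := k%:R / y.
have yk : y < k%:R by apply: ln_sublinear.
have x1 : 1 <= x by rewrite ler_pdivlMr // mul1r ltW.
pose n := (Num.truncn (64 * r%:R * x)).+1.
have [n_gt n_le] : 64 * r%:R * x < n%:R /\ n%:R <= 64 * r%:R * x + 1.
  have /truncn_itv/andP[h1 h2] : 0 <= 64 * r%:R * x by nra.
  by split=> //; rewrite /n -natr1 lerD2r.
exists n; first by nra.
have xy : x * y = k%:R by rewrite /x divfK ?gt_eqF.
have nk : n%:R <= k%:R :> R by nra.
have n64 : 64 * r%:R < n%:R :> R by nra.
have kN : (0 < k)%N by rewrite -(ltr_nat R).
have rn : (r.*2 < n)%N by rewrite -(ltr_nat R) -mul2n natrM; lra.
set d := (16 * r * k %/ n)%N; set N := 'C(n, 2).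
have N2 : (N.*2 = n * n.-1)%N := bin2_double n.
apply: (@list_ramsey_criterion n (2 * k) k r d N./2) => //.
- by rewrite leq_half_double -addnn -addnS leq_addr.
- have h1 : (N - 'C(n - r.*2, 2) <= r.*2 * n.-1)%N.
    by apply: bin2_sub; [rewrite double_gt0|exact: ltnW].
  have h2 : (16 * r * k < d.+1 * n)%N by apply: ltn_ceil.
  have h3 : (16 * r * k * n.-1 <= d.+1 * n * n.-1)%N by rewrite leq_mul2r ltnW ?orbT.
  have h4 : (d.+1 * n * n.-1 <= 4 * (d.+1 * (N - N./2)))%N.
    by rewrite -mulnA -N2 mulnCA leq_mul2l half_compl.
  have h5 : (2 * k * (N - 'C(n - r.*2, 2)) <= 2 * k * (r.*2 * n.-1))%N by rewrite leq_mul2l h1 orbT.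
  apply: leq_trans h5 _; rewrite -(leq_pmul2l (isT : 0 < 4)%N); apply: leq_trans h4.
  by apply: leq_trans h3; apply: eq_leq; rewrite -mul2n; ring.
apply: (@exp_count R) => //.
- by rewrite bin_gt0 leq_pmull.
- by rewrite leq_bin2l ?leq_subr.
set b := 'C(_ - d, k); set B := 'C(_, k).
have B0 : (0 < B)%N by rewrite bin_gt0 leq_pmull.
(* [e] is the square root of [k]. *)
pose e := expR (y / 2).
have e0 : 0 < e := expR_gt0 _.
have ek : e ^+ 2 = k%:R by rewrite /e -expRM_natl ky; congr expR; field.
have nx : k%:R / n%:R <= y / (64 * r%:R).
  rewrite ler_pdivrMr; last by nra.
  rewrite mulrAC ler_pdivlMr; last by nra.
  nra.
have bB : e^-1 <= b%:R / B%:R :> R.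
  pose z : R := 16 * (r%:R / n%:R).
  have n0 : 0 < n%:R :> R by rewrite ltr0n.
  have dn : (d * n <= 16 * r * k)%N by apply: leq_divM.
  have da : (d <= k)%N.
    rewrite -(@leq_pmul2r n) //; apply: leq_trans dn _; rewrite mulnC leq_mul2l.
    by apply/orP; right; rewrite -(ler_nat R) natrM; lra.
  have z0 : 0 <= z by rewrite /z; apply: mulr_ge0 => //; apply: divr_ge0.
  have z2 : z <= 2^-1 by rewrite /z mulrA ler_pdivrMr //; lra.
  have ratio := @bin_ratio (2 * k) d k.+1 k.
  have dz : 1 - z <= (k.+1 - d)%:R / k.+1%:R :> R.
    rewrite natrB; last exact: leqW.
    rewrite mulrBl divff ?pnatr_eq0 // lerD2l lerN2 /z mulrA ler_pdivrMr ?ltr0n //.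
    rewrite mulrAC ler_pdivlMr // -natrM -!natrM ler_nat.
    by apply: leq_trans dn _; rewrite leq_mul2l leqnSn orbT.
  apply: (@le_trans _ _ (((k.+1 - d)%:R / k.+1%:R) ^+ k)); last first.
    rewrite expr_div_n ler_pdivrMr ?exprn_gt0 ?ltr0n // mulrAC ler_pdivlMr ?ltr0n //.
    by rewrite mulrC -!natrX -!natrM ler_nat; apply: ratio; rewrite addSn addnn mul2n.
  apply: (@le_trans _ _ ((1 - z) ^+ k)); last first.
    by rewrite lerXn2r // nnegrE; [lra|exact: divr_ge0].
  apply: (@le_trans _ _ (expR (- (2 * z)) ^+ k)); last first.
    by rewrite lerXn2r // ?nnegrE ?expR_ge0 ?one_sub_ge_exp //; lra.
  rewrite -expRM_natl /e -expRN ler_expR.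
  have : z * k%:R = 16 * r%:R * (k%:R / n%:R) by rewrite /z; ring.
  have : 16 * r%:R * (k%:R / n%:R) <= 16 * r%:R * (y / (64 * r%:R)).
    by rewrite ler_wpM2l //; nra.
  have : 16 * r%:R * (y / (64 * r%:R)) = y / 4 by field; lra.
  lra.
apply: (@lt_le_trans _ _ ((N./2)%:R * e^-1)); last by rewrite ler_wpM2l.
have lnn : ln (n%:R : R) <= y by rewrite ler_ln ?posrE //; nra.
have N16 : n%:R ^+ 2 <= 16 * (N./2)%:R :> R.
  by rewrite -natrX -natrM ler_nat half_bin2_ge // -(ler_nat R); lra.
(* The fourth power beats the [y ^+ 3] that comes from the logarithm of [n] and
   the square of [ln k] in [n ^+ 2]. *)
have ey : y ^+ 4 / 384 <= e.
  have := @expR_ge1Dxn R (y / 2) 3; rewrite -/e => h.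
  apply: le_trans (h _); last by lra.
  have -> : y ^+ 4 / 384 = (y / 2) ^+ 4 / 4`!%:R.
    by rewrite (_ : 4`! = 24)%N //; field.
  by rewrite lerDr ler01.
rewrite ltr_pdivlMr //.
have y3 : y ^+ 3 < 64 * r%:R * e.
  apply: (@lt_le_trans _ _ (64 * r%:R * (y ^+ 4 / 384))); last by rewrite ler_wpM2l //; lra.
  have -> : 64 * r%:R * (y ^+ 4 / 384) = y ^+ 3 * (y * r%:R / 6) by field.
  by rewrite ltr_pMr ?exprn_gt0 //; nra.
apply: (@le_lt_trans _ _ (4 * r%:R * e ^+ 3 * y)).
  rewrite -mul2n !natrM -ek.
  have -> : 4 * r%:R * e ^+ 3 * y = 2 * r%:R * (2 * e ^+ 2) * y * e by ring.
  apply: ler_wpM2r; first exact: ltW.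
  apply: (ler_wpM2l _ lnn); apply: mulr_ge0; first exact: mulr_ge0.
  by apply: mulr_ge0 => //; apply: sqr_ge0.
apply: (@lt_le_trans _ _ (256 * (r%:R * x) ^+ 2)); last first.
  have : (64 * (r%:R * x)) ^+ 2 <= n%:R ^+ 2 by rewrite lerXn2r // ?nnegrE; nra.
  rewrite exprMn; lra.
have y20 : 0 < y ^+ 2 by rewrite exprn_gt0.
rewrite -(ltr_pM2r y20).
have -> : 256 * (r%:R * x) ^+ 2 * y ^+ 2 = 256 * r%:R ^+ 2 * (x * y) ^+ 2 by ring.
rewrite xy -ek.
have -> : 4 * r%:R * e ^+ 3 * y * y ^+ 2 = (4 * r%:R * e ^+ 3) * y ^+ 3 by ring.
have -> : 256 * r%:R ^+ 2 * (e ^+ 2) ^+ 2 = (4 * r%:R * e ^+ 3) * (64 * r%:R * e) by ring.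
by rewrite ltr_pM2l // !mulr_gt0 ?exprn_gt0 //; lra.
Qed.

Lemma stars_avoid n k : (1 < n)%N -> 1 <= ln k%:R :> R ->
  n%:R < k%:R / ln k%:R :> R -> ('C(n, 2) * (n - 2) ^ k < n ^ k)%N.
Proof.
move=> n1; set y : R := ln k%:R => y1 nk.
have n0 : 0 < n%:R :> R by rewrite ltr0n; lia.
have ny : n%:R * y < k%:R by rewrite -ltr_pdivlMr //; lra.
have k0 : 0 < k%:R :> R by nra.
have lnn : ln (n%:R : R) <= y by rewrite ler_ln ?posrE //; nra.
apply: (@leq_ltn_trans (n ^ 2 * (n - 2) ^ k)).
  by rewrite leq_mul2r -mulnn; have := bin2_double n; nia.
apply: (@exp_count R); [exact: ltnW|exact: ltnW|exact: n1|].
rewrite mulrCA ltr_pM2l //; apply: le_lt_trans lnn _.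
by rewrite ltr_pdivlMr // mulrC.
Qed.
End Forcing.

(** * Asymptotics *)

Section Asymptotics.
Variable R : realType.
Local Open Scope classical_set_scope.
Local Open Scope ring_scope.

Lemma list_ramsey_large_r k q : (0 < k)%N -> (0 < q)%N ->
  exists r0, forall r, (r0 <= r)%N ->
    (2 * r <= list_ramsey (matching r) k <= 2 * r + r %/ q)%N.
Proof.
move=> k0 q0; have [r0 H] := forcing_nearly_spanning R k0 q0.
exists r0 => r /H HL; rewrite list_ramsey_le // andbT.
apply: (@list_ramsey_ind r k (fun m => 2 * r <= m)%N); first by exists (2 * r + r %/ q)%N.
move=> n; exact: forcing_size.
Qed.

Lemma list_ramsey_large_k r k : (2 <= r)%N -> 128 * r%:R + 64 <= ln k%:R :> R ->
  k%:R / ln k%:R <= (list_ramsey (matching r) k)%:R :> R /\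
  (list_ramsey (matching r) k)%:R <= 65 * r%:R * (k%:R / ln k%:R) :> R.
Proof.
move=> r2 rk; have r0 : (0 < r)%N by lia.
have [n n_le HL] := forcing_few_vertices r0 rk.
split; last by apply: le_trans n_le; rewrite ler_nat list_ramsey_le.
apply: (@list_ramsey_ind r k (fun m => k%:R / ln k%:R <= m%:R)); first by exists n.
have lnk1 : 1 <= ln k%:R :> R by have : 0 <= r%:R :> R by []; lra.
have k0 : (0 < k)%N by case: (k) lnk1 => //; rewrite ln0 ?ler10.
move=> m fm; rewrite leNgt; apply/negP => mx.
have m4 := forcing_size k0 fm; have [L [Lk LP]] := fm.
have m1 : (1 < m)%N by lia.
have [|c cL []] := list_ramsey_obstruction (ltnW m1) r2 Lk.
  exact: stars_avoid lnk1 mx.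
exact: LP.
Qed.

Lemma near_ln_ge (C : R) : \forall k \near \oo, C <= ln k%:R :> R.
Proof.
exists (Num.truncn (expR C)).+1 => // k /= kC.
have h : expR C < k%:R.
  have := truncnS_gt (expR C); move=> /lt_le_trans; apply; by rewrite ler_nat.
by rewrite -ler_expR lnK ?posrE ?(lt_trans _ h) ?expR_gt0 // ltW.
Qed.

Lemma ramsey_bounds_real r k : (0 < k)%N -> (0 < r)%N ->
  (k%:R + 1) * (r%:R - 1) + 1 <= (ramsey (matching r) k)%:R :> R /\
  (ramsey (matching r) k)%:R <= (k%:R + 1) * (r%:R - 1) + 2 :> R.
Proof.
move=> k0 r0; have /andP[lo hi] := ramsey_bounds k0 r0.
have E : (k%:R + 1) * (r%:R - 1) = (k.+1 * r.-1)%:R :> R.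
  by rewrite natrM -natr1 -subn1 natrB.
by rewrite E natr1 -natrD !ler_nat.
Qed.

Lemma inv_le_eps (eps : R) : 0 < eps -> exists2 q, (0 < q)%N & q%:R^-1 <= eps.
Proof.
move=> e0; exists (Num.truncn eps^-1).+1 => //.
by rewrite -[leRHS]invrK lef_pV2 ?posrE ?invr_gt0 ?ltr0n // ltW // truncnS_gt.
Qed.

End Asymptotics.

Local Open Scope classical_set_scope.
Local Open Scope ring_scope.

Theorem theorem3 (R : realType) :
  (forall k : nat, (2 <= k)%N ->
     ((fun r : nat => (list_ramsey (matching r) k)%:R : R)
        = (fun r => 2 * r%:R) +o_\oo (fun r => r%:R : R))
     /\
     ((fun r : nat => (ramsey (matching r) k)%:R
                        / (list_ramsey (matching r) k)%:R : R)
        = (fun _ => (k%:R + 1) / 2) +o_\oo (fun _ => 1 : R)))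
  /\
  (forall r : nat, (2 <= r)%N ->
     ((fun k : nat => (list_ramsey (matching r) k)%:R : R)
        =Theta_\oo (fun k => k%:R / ln k%:R : R))
     /\
     ((fun k : nat => (ramsey (matching r) k)%:R
                        / (list_ramsey (matching r) k)%:R : R)
        =Theta_\oo (fun k => ln k%:R : R))).
Proof.
split=> [k k2|r r2].
  have k0 : (0 < k)%N by lia.
  split; apply/eqaddoP => eps /= e0.
    have [q q0 qe] := inv_le_eps e0.
    have [r0 H] := list_ramsey_large_r R k0 q0.
    exists r0 => // r /= /H/andP[]; rewrite -(ler_nat R) -[(_ <= _ + _)%N](ler_nat R) => lo hi.
    rewrite !fctE ger0_norm; last by rewrite subr_ge0 -natrM.
    rewrite ger0_norm // lerBlDl; apply: le_trans hi _; rewrite natrD natrM lerD2l.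
    apply: (@le_trans _ _ (r%:R / q%:R)); last by rewrite mulrC ler_wpM2r.
    by rewrite ler_pdivlMr ?ltr0n // -natrM ler_nat leq_divM.
  have K0 : 0 < k%:R + 1 :> R by rewrite natr1 ltr0n.
  have [q q0 qe] := inv_le_eps (divr_gt0 e0 K0).
  have [r0 H] := list_ramsey_large_r R k0 q0.
  exists (r0 + 2 * q)%N => // r /= rr.
  have /H/andP[] : (r0 <= r)%N by lia.
  rewrite -(ler_nat R) -[(_ <= _ + _)%N](ler_nat R) => lo hi.
  have r0' : (0 < r)%N by lia.
  have [rlo rhi] := ramsey_bounds_real R k0 r0'.
  rewrite !fctE normr1 mulr1.
  set x : R := (ramsey _ _)%:R in rlo rhi *.
  set y : R := (list_ramsey _ _)%:R in lo hi *.
  have rq : 2 * q%:R <= r%:R :> R by rewrite -natrM ler_nat; lia.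
  have q0' : 0 < q%:R :> R by rewrite ltr0n.
  have {}hi : y <= 2 * r%:R + r%:R * q%:R^-1.
    apply: le_trans hi _; rewrite natrD natrM lerD2l.
    by rewrite ler_pdivlMr // -natrM ler_nat leq_divM.
  rewrite natrM in lo.
  have K2 : (k%:R + 1) * q%:R^-1 <= eps by rewrite mulrC -ler_pdivlMr.
  have qV : q%:R * q%:R^-1 = 1 :> R by rewrite divff ?gt_eqF.
  have y0 : 0 < y by lra.
  (* [2 x] and [(k + 1) y] are both [2 (k + 1) r], up to a constant for the former
     and up to [(k + 1) r / q] for the latter. *)
  have -> : x / y - (k%:R + 1) / 2 = (2 * x - (k%:R + 1) * y) / (2 * y).
    by field; rewrite gt_eqF.
  rewrite normf_div (ger0_norm (_ : 0 <= 2 * y)); last by lra.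
  rewrite ler_pdivrMr; last by lra.
  rewrite ler_norml; apply/andP; split.
  - have Kq : k%:R + 1 <= eps * q%:R.
      by rewrite -ler_pdivrMr.
    have K1 : 2 * (k%:R + 1) <= eps * r%:R by nra.
    have K3 : (k%:R + 1) * (r%:R * q%:R^-1) <= eps * r%:R.
      by rewrite mulrCA mulrC ler_wpM2r.
    have K4 : (k%:R + 1) * y <= 2 * ((k%:R + 1) * r%:R) + (k%:R + 1) * (r%:R * q%:R^-1).
      have := ler_wpM2l (ltW K0) hi; lra.
    have K5 : eps * (2 * r%:R) <= eps * y by rewrite ler_wpM2l // ltW.
    have := mulr_gt0 e0 y0; lra.
  have K1 : (k%:R + 1) * (2 * r%:R) <= (k%:R + 1) * y by rewrite ler_wpM2l // ltW.
  have K3 : 2 <= k%:R :> R by rewrite (ler_nat R 2).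
  have := mulr_gt0 e0 y0; lra.
split; rewrite eqThetaE qualifE; apply/asboolP.
  exists (1, 65 * r%:R) => /=; first by rewrite ltr01 mulr_gt0 // ltr0n; lia.
  apply: filterS (near_ln_ge (128 * r%:R + 64 : R)) => k lnk.
  have [lo hi] := list_ramsey_large_k r2 lnk.
  rewrite !ger0_norm // ?mul1r //.
  by apply: divr_ge0 => //; have : 0 <= r%:R :> R by []; lra.
exists ((65 * r%:R)^-1, 3 * r%:R) => /=.
  by rewrite invr_gt0 !mulr_gt0 // ltr0n; lia.
apply: filterS (near_ln_ge (128 * r%:R + 64 : R)) => k lnk.
have [lo hi] := list_ramsey_large_k r2 lnk.
have r1 : 2 <= r%:R :> R by rewrite (ler_nat R 2).
have lnk0 : 0 < ln k%:R :> R by lra.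
have k0 : (0 < k)%N by case: (k) lnk0 => //; rewrite ln0 ?ltxx.
have k1 : 1 <= k%:R :> R by rewrite (ler_nat R 1).
have [rlo rhi] := ramsey_bounds_real R k0 (ltnW r2).
set a : R := (ramsey _ _)%:R in rlo rhi *.
set b : R := (list_ramsey _ _)%:R in lo hi *.
set y : R := ln k%:R in lnk lnk0 lo hi *.
have b0 : 0 < b by apply: lt_le_trans lo; rewrite divr_gt0 //; lra.
have a0 : 0 <= a by apply: ler0n.
rewrite (ger0_norm (ltW lnk0)) (ger0_norm (divr_ge0 a0 (ltW b0))); split.
  rewrite ler_pdivlMr // -mulrA ler_pdivrMl; last by lra.
  have yb : y * b <= 65 * r%:R * k%:R.
    by rewrite mulrC -ler_pdivlMr //; apply: le_trans hi _; rewrite mulrA.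
  apply: le_trans yb _; apply: ler_wpM2l; [lra|nra].
rewrite ler_pdivrMr //.
have yb : k%:R <= b * y by rewrite -ler_pdivrMr.
apply: le_trans rhi _.
apply: (@le_trans _ _ (3 * r%:R * k%:R)); first by nra.
by rewrite -[leRHS]mulrA [y * b]mulrC; apply: ler_wpM2l => //; lra.
Qed.
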